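(* Let $s>2$ and let $\Gamma$ be an $(s,g)$-graph on $n$ vertices. Let $k = as+b$, where $a,b$ are non-negative integers with $s > b \ge a+1$, and suppose that $g \ge k$ and $s<k$. Let $\mathcal{C}$ be the fractional repetition code obtained from $\Gamma$ by taking the edges of $\Gamma$ as symbols and letting each vertex of $\Gamma$ be a storage node storing the symbols (edges) incident on it (so $\theta = ns/2$, $\alpha = s$, and the local repair degree is $r=s$). Then for file size $\mathcal{M} = k(s-1)$ the code $\mathcal{C}$ is optimal with respect to the locality bound, i.e. its minimum distance satisfies $$d_{\min} = n - \left\lceil \frac{\mathcal{M}}{\alpha}\right\rceil - \left\lceil \frac{\mathcal{M}}{r\alpha}\right\rceil + 2, \qquad \text{with } \alpha = r = s .$$
   Context: An undirected (finite, simple) graph $\Gamma$ is an $(s,g)$-graph if every vertex has degree $s$ and the length of a shortest cycle in $\Gamma$ is $g$. Storage system: a file of $\mathcal{M}$ symbols is encoded by a $(\theta,\mathcal{M})$-MDS code into $\theta$ symbols ($\mathcal{M}\le\theta$), which are placed on $n$ storage nodes; each node is identified with the $\alpha$-element subset of the $\theta$ symbols that it stores. A set of nodes can recover the file if and only if the union of these nodes contains at least $\mathcal{M}$ distinct symbols. The minimum distance $d_{\min}$ (for file size $\mathcal{M}$) is the smallest size of a set of nodes whose failure makes the file not recoverable from the surviving nodes, i.e. the smallest $|F|$ over sets $F$ of nodes such that the nodes outside $F$ together contain fewer than $\mathcal{M}$ distinct symbols. The local repair degree $r$ is the number of surviving nodes contacted to repair a failed node, downloading $\alpha/r$ symbols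 from each; in the code here a failed node is repaired by downloading one symbol from each of its $s$ neighbours in $\Gamma$, so $r=s$. The number $k$ is the number of nodes to be contacted for recovering the file, and a locally repairable system has $r<k$. The locality bound says that a locally recoverable system with $n$ nodes, $\alpha$ symbols per node, local repair degree $r$ and file size $\mathcal{M}$ satisfies $d_{\min}\le n-\lceil \mathcal{M}/\alpha\rceil-\lceil \mathcal{M}/(r\alpha)\rceil+2$; a code is optimal with respect to it if equality holds. *)

(* Defs.v *)
From mathcomp Require Import all_boot all_order all_algebra.
Set Implicit Arguments.
Unset Strict Implicit.
Unset Printing Implicit Defensive.

Section Graphs.

Variables (V : finType) (e : rel V).

(* The bound on the size excludes the degenerate closed walks of length at most
   two, which [cycle] accepts: [::] and, for an edge xy, [:: x; y]. *)
Definition graph_cycle (c : seq V) : bool := [&& cycle e c, uniq c & 2 < size c].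

Definition has_girth (g : nat) : Prop :=
  (exists2 c, graph_cycle c & size c = g) /\
  (forall c, graph_cycle c -> g <= size c).

Definition sg_graph (s g : nat) : Prop :=
  [/\ symmetric e, irreflexive e,
      forall x, #|[set y | e x y]| = s
    & has_girth g].

Definition edges : {set {set V}} := [set [set p.1; p.2] | p : V * V & e p.1 p.2].

Definition edge : finType := {d : {set V} | d \in edges}.

Definition fr_code (v : V) : {set edge} := [set d : edge | v \in val d].

End Graphs.

(* A storage system with symbols T and nodes N is given by the set of symbols
   stored on each node; of the outer
   (#|T|, M)-MDS code only M <= #|T| and the recovery criterion matter. *)
Section Storage.

Variables (T N : finType) (store : N -> {set T}).

Definition recoverable (M : nat) (A : {set N}) : bool :=
  M <= #|\bigcup_(v in A) store v|.

(* The witness [set: N] is admissible as soon as 0 < M; for M = 0 no failure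
   is fatal and the value is irrelevant. *)
Definition d_min (M : nat) : nat :=
  #|[arg min_(F < [set: N] | ~~ recoverable M (~: F)) #|F|]|.

(* [down u] is the set of alpha / r symbols downloaded from the helper u. *)
Definition local_repair (alpha r : nat) : Prop :=
  forall v : N, exists (R : {set N}) (down : N -> {set T}),
    [/\ v \notin R, #|R| = r,
        forall u, u \in R -> down u \subset store u /\ r * #|down u| = alpha
      & \bigcup_(u in R) down u = store v].

Definition locally_recoverable (alpha r M : nat) : Prop :=
  [/\ M <= #|T|, forall v, #|store v| = alpha & local_repair alpha r].

Definition locality_bound (n alpha r M : nat) : int :=
  (Posz n - Num.ceil (M%:R / alpha%:R : rat)
        - Num.ceil (M%:R / (r%:R * alpha%:R) : rat) + 2)%R.

Definition locality_optimal (alpha r M : nat) : Prop :=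
  locally_recoverable alpha r M /\
  Posz (d_min M) = locality_bound #|N| alpha r M.

End Storage.

(* Main.v *)
(** In a graph of girth at least [g], a nonempty vertex set [A] with [|A| < g]
    has a vertex with at most one neighbour in [A], and if [|A| = g] one with at
    most two.  Removing such vertices one by one, each removal uncovers at least
    [s - 1] edges ([s - 2] for the first one if [|A| = g]), so [A] covers at
    least [|A| (s - 1)] edges when [1 < |A| <= g].  Hence any [k <= g] nodes
    recover the file, while the [k - 1] nodes of a path cover at most
    [(k - 1) (s - 1) + 1 < k (s - 1)] edges: [d_min = n - k + 1].  The conditions
    on [a] and [b] make the two ceilings equal to [k - a] and [a + 1]. *)

Require Import Defs.
From mathcomp Require Import all_boot all_order all_algebra.
From mathcomp Require Import zify.
Set Implicit Arguments.
Unset Strict Implicit.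
Unset Printing Implicit Defensive.

(** * Ceilings of quotients and sizes of unions *)

Lemma ceil_divn (M d q : nat) :
  0 < d -> q * d < M -> M <= q.+1 * d ->
  Num.ceil (M%:R / d%:R : rat)%R = Posz q.+1.
Proof.
move=> d0 lo hi; apply: Num.Theory.ceil_def.
have d0r : (0 < d%:R :> rat)%R by rewrite Num.Theory.ltr0n.
have -> : (Posz q.+1 - 1 = q)%R by lia.
rewrite Num.Theory.ltr_pdivlMr // Num.Theory.ler_pdivrMr //.
rewrite -!pmulrn -!GRing.natrM.
by rewrite Num.Theory.ltr_nat Num.Theory.ler_nat lo.
Qed.

Lemma cards_bigcup_le1 (I T : finType) (P : {set I}) (F : I -> {set T}) :
  (forall i, i \in P -> #|F i| <= 1) -> #|\bigcup_(i in P) F i| <= #|P|.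
Proof.
move=> F1; rewrite -[leqRHS]sum1_card.
elim/big_rec2: _ => [|i n A Pi le_An]; first by rewrite cards0.
by rewrite (leq_trans (leq_card_setU _ _)) ?leq_add ?F1.
Qed.

(** * Short cycles from a minimum degree *)

Section ShortCycles.

Variables (V : finType) (e : rel V).
Hypothesis e_sym : symmetric e.
Hypothesis e_irr : irreflexive e.

(* The cycle closes the starting point of a path that cannot be extended inside
   [A]: its neighbours in [A] all lie on the path, and the nearest one beyond
   the first step has at least [d] others behind it. *)
Lemma short_cycle_of_min_degree (A : {set V}) (d : nat) :
    A != set0 ->
    (forall x, x \in A -> d + 2 <= #|[set y in A | e x y]|) ->
  exists2 c, graph_cycle e c & size c + d <= #|A|.
Proof.
move=> /set0Pn[x0 Ax0] degA.
have [p [x [pxA up ep Nxp]]] : exists p x,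
  [/\ {subset x :: p <= A}, uniq (x :: p), path e x p
    & forall y, y \in A -> e x y -> y \in p].
  (* The path grows at its head, starting from [x0]; [m] bounds the number of vertices of [A] off
     the path, so the growth ends. *)
  have [m] := ubnPleq (#|A| - size [:: x0]).
  have : path e x0 [::] by [].
  have : uniq [:: x0] by [].
  have : {subset [:: x0] <= A} by move=> y; rewrite inE => /eqP->.
  move: [::] x0 {Ax0} => p x; move En : (size (x :: p)) => n.
  move=> sA up ep le_m.
  elim: m => [|m IHm] in p x n En sA up ep le_m *.
    exists p, x; split=> // y Ay exy; apply: contraT => yp.
    have : size [:: y, x & p] <= #|A|.
      rewrite -(card_uniqP _) ?subset_leq_card //.
        by apply/subsetP=> z; rewrite inE => /predU1P[->|/sA].
      rewrite cons_uniq up andbT inE negb_or yp andbT.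
      by apply: contraTneq exy => ->; rewrite e_irr.
    by move: En le_m => /=; lia.
  case: (boolP [exists y, [&& y \in A, e x y & y \notin p]]) => [|no_ext].
    case/existsP=> y /and3P[Ay exy yp].
    apply: (IHm (x :: p) y n.+1) => /=.
    - by rewrite -En.
    - by move=> z; rewrite inE => /predU1P[->|/sA].
    - move: up => /= ->; rewrite inE negb_or yp !andbT.
      by apply: contraTneq exy => ->; rewrite e_irr.
    - by rewrite e_sym exy.
    - by lia.
  exists p, x; split=> // y Ay exy; apply: contraNT no_ext => yp.
  by apply/existsP; exists y; rewrite Ay exy.
have sizeA : size (x :: p) <= #|A|.
  by rewrite -(card_uniqP _) ?subset_leq_card //; apply/subsetP.
have := degA x (pxA x (mem_head _ _)).
case: p => [|x1 q] in pxA up ep Nxp sizeA *.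
  rewrite (_ : [set y in A | e x y] = set0) ?cards0 ?addn2 //.
  by apply/setP=> y; rewrite !inE; apply/andP=> -[/Nxp H /H].
set N := [set _ in _ | _] => degx.
(* The cycle closes at the entry of [q] with index [i], the first neighbour of [x] after [x1], and
   has length [i + 3]. All neighbours in [A] lie in [x1 :: drop i q], so at least [d] entries of [q]
   remain behind that one. *)
pose i := find (e x) q.
have leN : #|N| <= (size q - i).+1.
  rewrite -size_drop -[_.+1]/(size (x1 :: drop i q)).
  apply: leq_trans (card_size _); apply/subset_leq_card/subsetP=> y.
  rewrite !inE => /andP[Ay exy]; have := Nxp y Ay exy; rewrite inE.
  case/predU1P=> [->|yq]; first by rewrite eqxx.
  apply/orP; right; move: yq; rewrite -{1}(cat_take_drop i q) mem_cat.
  case/orP=> // yt; have /hasP : exists2 z, z \in take i q & e x z by exists y.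
  by rewrite has_take_leq ?find_size // ltnn.
have ltid : i + d < size q by have := leq_trans degx leN; lia.
have lti : i < size q by apply: leq_ltn_trans ltid; apply: leq_addr.
have hasq : has (e x) q by rewrite has_find.
exists [:: x, x1 & take i.+1 q]; last first.
  by apply: leq_trans sizeA; rewrite /= size_takel // addSn !ltnS addSn.
have tq : [:: x, x1 & take i.+1 q] = take i.+3 [:: x, x1 & q] by [].
apply/and3P; split.
- rewrite /cycle rcons_path -[x1 :: _]/(take i.+2 (x1 :: q)) take_path //=.
  rewrite (take_nth x) // last_rcons e_sym; exact: nth_find.
- by rewrite tq take_uniq.
- by rewrite /= size_takel.
Qed.

(** Otherwise all degrees inside [A] are at least [d + 2], which yields a cycle of length at most
    [#|A| - d < g]. The cases [d = 0] and [d = 1] serve [#|A| < g] and [#|A| <= g]. *)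
Lemma exists_low_degree (A : {set V}) (g d : nat) :
    (forall c, graph_cycle e c -> g <= size c) ->
    A != set0 -> #|A| < g + d ->
  exists2 x, x \in A & #|[set y in A | e x y]| <= d.+1.
Proof.
move=> girth A0 ltA.
case: (boolP [exists x in A, #|[set y in A | e x y]| <= d.+1]).
  by case/exists_inP=> x; exists x.
rewrite negb_exists_in => /forall_inP degA.
case: (@short_cycle_of_min_degree A d) => // [x /degA|c /girth gc lec]; lia.
Qed.

End ShortCycles.

(** * Edges as symbols, vertices as nodes *)

Section Coverage.

Variables (V : finType) (e : rel V) (s g : nat).
Hypothesis G : sg_graph e s g.

Let e_sym : symmetric e. Proof. by case: G. Qed.
Let e_irr : irreflexive e. Proof. by case: G. Qed.
Let e_deg x : #|[set y | e x y]| = s. Proof. by case: G. Qed.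
Let girth c : graph_cycle e c -> g <= size c.
Proof. by case: G => _ _ _ [_]; apply. Qed.

Local Notation store := (@fr_code V e).

Lemma val_edgeP (d : edge e) : exists x y, e x y /\ val d = [set x; y].
Proof.
by case: d => d /= /imsetP[[x y]]; rewrite inE /= => exy ->; exists x, y.
Qed.

Lemma card_val_edge (d : edge e) : #|val d| = 2.
Proof.
have [x [y [exy ->]]] := val_edgeP d; rewrite cards2.
by case: eqP exy => // ->; rewrite e_irr.
Qed.

Lemma edge_joins (d : edge e) v :
  v \in val d -> exists2 u, e v u & val d = [set v; u].
Proof.
have [x [y [exy ->]]] := val_edgeP d; rewrite !inE.
by case/orP=> /eqP->; [exists y | exists x; rewrite 1?e_sym 1?setUC].
Qed.

Lemma val_edge_eq (d : edge e) u v :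
  u != v -> u \in val d -> v \in val d -> val d = [set u; v].
Proof.
move=> uv ud vd; apply/esym/eqP; rewrite eqEcard card_val_edge cards2 uv andbT.
by rewrite subUset !sub1set ud.
Qed.

Lemma fr_code_meet_le1 u v : u != v -> #|store u :&: store v| <= 1.
Proof.
move=> uv; apply/card_le1P => d; rewrite !inE => /andP[ud vd] d'.
rewrite !inE; apply/andP/eqP => [[ud' vd']|-> //].
by apply: val_inj; rewrite (val_edge_eq uv ud vd) (val_edge_eq uv ud' vd').
Qed.

Lemma fr_code_meet u v : e u v -> #|store u :&: store v| = 1.
Proof.
move=> euv; have uv : u != v by apply: contraTneq euv => ->; rewrite e_irr.
have uvE : [set u; v] \in edges e by apply/imsetP; exists (u, v); rewrite ?inE.
apply/eqP; rewrite eqn_leq fr_code_meet_le1 // card_gt0.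
by apply/set0Pn; exists (exist _ [set u; v] uvE); rewrite !inE /= !eqxx orbT.
Qed.

(** This is the repair of [v]: each neighbour returns the edge it shares with [v]. *)
Lemma fr_code_bigcup v :
  \bigcup_(u in [set u | e v u]) (store v :&: store u) = store v.
Proof.
apply/setP=> d; apply/bigcupP/idP=> [[u _]|]; first by rewrite inE => /andP[].
move=> vd; have /edge_joins[u evu Ed] : v \in val d by rewrite inE in vd.
by exists u; rewrite !inE // Ed !inE !eqxx orbT.
Qed.

Lemma card_fr_code v : #|store v| = s.
Proof.
have NvE : val @: store v = [set [set v; u] | u in [set u | e v u]].
  apply/setP=> D; apply/imsetP/imsetP=> [[d]|[u]]; rewrite inE.
    by move=> /edge_joins[u evu ->] ->; exists u; rewrite ?inE.
  move=> evu ->; have uvE : [set v; u] \in edges e.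
    by apply/imsetP; exists (v, u); rewrite ?inE.
  by exists (exist _ [set v; u] uvE); rewrite ?inE //= eqxx.
rewrite -(card_imset _ val_inj) NvE card_in_imset ?e_deg // => u u'.
rewrite !inE => evu _ /setP/(_ u); rewrite !inE eqxx orbT.
by case: eqP evu => [->|_ _ /esym/eqP //]; rewrite e_irr.
Qed.

(** Incident pairs of a vertex and an edge are counted in two ways. *)
Lemma handshake : 2 * #|edge e| = #|V| * s.
Proof.
have -> : 2 * #|edge e| = \sum_(d : edge e) \sum_(v in val d) 1.
  rewrite mulnC -sum_nat_const; apply: eq_bigr => d _.
  by rewrite sum1_card card_val_edge.
rewrite (exchange_big_dep xpredT) //= -sum_nat_const; apply: eq_bigr => v _.
by rewrite -(card_fr_code v) -sum1_card; apply: eq_bigl => d; rewrite inE.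
Qed.

(** * Number of edges covered by a vertex set *)

Definition coverage (A : {set V}) := #|\bigcup_(v in A) store v|.

(** Of the [s] edges at [v], only those leading to a neighbour in [A] stay covered without [v], one
    for each such neighbour. *)
Lemma coverage_setD1 (A : {set V}) v : v \in A ->
  coverage (A :\ v) + s <= coverage A + #|[set y in A | e v y]|.
Proof.
move=> Av; rewrite /coverage (big_setD1 v Av) /=.
have := cardsUI (store v) (\bigcup_(u in A :\ v) store u).
rewrite card_fr_code [_ + s]addnC => <-; rewrite leq_add2l.
apply: leq_trans (cards_bigcup_le1 (F := fun u => store v :&: store u) _).
  apply/subset_leq_card/subsetP=> d /setIP[vd /bigcupP[u]].
  rewrite !inE => /andP[uv Au] ud; rewrite inE in vd.
  have [w evw dE] := edge_joins vd.
  move: (ud); rewrite dE !inE (negPf uv) /= => /eqP uw.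
  by apply/bigcupP; exists u; rewrite !inE ?Au ?uw // vd -uw.
by move=> u; rewrite inE => /andP[_ /fr_code_meet ->].
Qed.

(** The edge [uv] is already covered through [u]. *)
Lemma coverage_setU1 (A : {set V}) u v : u \in A -> e u v ->
  coverage (v |: A) <= coverage A + (s - 1).
Proof.
move=> Au euv; rewrite /coverage bigcup_setU big_set1.
have := cardsUI (store v) (\bigcup_(w in A) store w).
rewrite card_fr_code.
suff : 0 < #|store v :&: \bigcup_(w in A) store w| by lia.
rewrite -(fr_code_meet euv) setIC subset_leq_card // setIS //.
exact: bigcup_sup.
Qed.

Let s_gt0 : 0 < s.
Proof.
case: G => _ _ _ [[c /and3P[cyc _ c_gt2] _] _].
case: c => [|x [|y c]] // in cyc c_gt2 *.
case/andP: cyc => exy _; rewrite -(e_deg x) card_gt0.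
by apply/set0Pn; exists y; rewrite inE.
Qed.

(** [A] induces a forest, so vertices with at most one neighbour can be peeled off, each uncovering
    at least [s - 1] edges. The last vertex accounts for all its [s] edges, whence the strict
    inequality. *)
Lemma coverage_acyclic (A : {set V}) :
  A != set0 -> #|A| < g -> #|A| * (s - 1) < coverage A.
Proof.
have [n] := ubnP #|A|; elim: n => // n IHn in A *; rewrite ltnS => leA A0 ltA.
have ltA0 : #|A| < g + 0 by rewrite addn0.
have [v Av degv] := exists_low_degree e_sym e_irr girth A0 ltA0.
have cardA := cardsD1 v A; rewrite Av add1n in cardA.
have := coverage_setD1 Av.
case: (eqVneq (A :\ v) set0) => [Av0|Av0].
  have -> : [set y in A | e v y] = set0.
    apply/setP=> y; rewrite !inE; apply/andP=> -[Ay evy].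
    have : y \in A :\ v.
      by rewrite !inE Ay andbT; apply: contraTneq evy => ->; rewrite e_irr.
    by rewrite Av0 inE.
  rewrite cardA Av0 !cards0; lia.
have : #|A :\ v| * (s - 1) < coverage (A :\ v) by apply: IHn => //; lia.
rewrite cardA; nia.
Qed.

(** The first vertex removed may have two neighbours in [A] and uncover only [s - 2] edges; the
    strict inequality for the remaining set makes up for the missing one. *)
Lemma coverage_lower (A : {set V}) :
  1 < #|A| -> #|A| <= g -> #|A| * (s - 1) <= coverage A.
Proof.
move=> A1 leA; have A0 : A != set0 by rewrite -card_gt0; lia.
have ltA1 : #|A| < g + 1 by lia.
have [v Av degv] := exists_low_degree e_sym e_irr girth A0 ltA1.
have cardA := cardsD1 v A; rewrite Av add1n in cardA.
have := coverage_setD1 Av.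
have := @coverage_acyclic (A :\ v); rewrite -card_gt0; lia.
Qed.

Lemma coverage_path x p :
  path e x p -> coverage [set:: x :: p] <= (size p).+1 * (s - 1) + 1.
Proof.
elim: p x => [|y p IHp] x /=.
  move=> _; rewrite /coverage set_cons set_nil setU0 big_set1 card_fr_code; lia.
case/andP=> exy /IHp; rewrite [in leqRHS]mulSn [[set:: x :: _]]set_cons.
have := @coverage_setU1 [set:: y :: p] y x.
rewrite inE mem_head e_sym => /(_ isT exy) le1 le2.
by apply: leq_trans le1 _; rewrite addnC -addnA leq_add2l.
Qed.

(** A segment of a cycle of length [g] serves. *)
Lemma exists_path m : 0 < m <= g -> exists x p,
  [/\ path e x p, uniq (x :: p) & size (x :: p) = m].
Proof.
case/andP=> m0 leg; case: G => _ _ _ [[c /and3P[cyc uc _] szc] _].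
case: c => [|x c] in cyc uc szc *; first by move: szc => /=; lia.
exists x, (take m.-1 c); case: m => // m in m0 leg *.
rewrite -[x :: _]/(take m.+1 (x :: c)) take_uniq // size_takel ?szc //.
move: cyc; rewrite /= rcons_path => /andP[xc _]; split=> //.
exact: take_path.
Qed.

Lemma d_min_fr_code k : 2 < s -> 1 < k <= g ->
  d_min store (k * (s - 1)) + k = #|V| + 1.
Proof.
move=> s2 /andP[k1 kg]; rewrite /d_min.
have nrec A : ~~ recoverable store (k * (s - 1)) A = (coverage A < k * (s - 1)).
  by rewrite /recoverable -ltnNge.
case: arg_minnP => [|F]; rewrite ?nrec.
  by rewrite setCT /coverage big_set0 cards0 muln_gt0; lia.
move=> covF minF; apply/eqP; rewrite eqn_leq; apply/andP; split.
  (* Failure of all nodes off a path of [k - 1] nodes is fatal: [2 < s] gives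
     [(k - 1) (s - 1) + 1 < k (s - 1)]. *)
  have [|x [p [xp up sz]]] := @exists_path k.-1; first by lia.
  have := minF (~: [set:: x :: p]).
  rewrite nrec setCK => /(_ _).
  have := coverage_path xp; have := cardsC [set:: x :: p].
  have -> : #|[set:: x :: p]| = k.-1 by rewrite cardsE (card_uniqP up).
  move: sz => /=; nia.
(* A smaller failure leaves at least [k] nodes, and any [k] of them cover enough edges. *)
rewrite leqNgt; apply/negP=> ltF.
have leF : k <= #|~: F| by have := cardsC F; lia.
have [B sBF cB] : exists2 B : {set V}, B \subset ~: F & #|B| = k.
  have /card_geqP[q [uq sq qF]] := leF; exists [set:: q].
    by apply/subsetP=> x; rewrite inE => /qF.
  by rewrite cardsE (card_uniqP uq).
have := @coverage_lower B; rewrite cB => /(_ k1 kg) covB.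
suff : coverage B <= coverage (~: F) by lia.
apply/subset_leq_card/bigcupsP=> v Bv.
apply: bigcup_sup; exact: subsetP sBF v Bv.
Qed.

End Coverage.

(** * Optimality of the code *)

Theorem lemma3 (V : finType) (e : rel V) (n s g k a b : nat)
    (hs : 2 < s) (hn : #|V| = n) (hG : sg_graph e s g)
    (hk : k = a * s + b) (hbs : b < s) (hab : a + 1 <= b)
    (hgk : k <= g) (hsk : s < k) :
  2 * #|edge e| = n * s /\
  locality_optimal (@fr_code V e) s s (k * (s - 1)).
Proof.
have shake : 2 * #|edge e| = n * s by rewrite -hn (handshake hG).
have k_itv : 1 < k <= g by lia.
split=> //; split; last first.
  have := d_min_fr_code hG hs k_itv; rewrite hn.
  rewrite /locality_bound -GRing.natrM.
  (* Since [k (s - 1) = (k - a) s - b] and [b < s], the first ceiling is [k - a]. Since also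
     [k (s - 1) = a s^2 + (b - a) s - b] with [a + 1 <= b < s], the second is [a + 1]. The bound
     becomes [n - k + 1]. *)
  rewrite (@ceil_divn _ s (k - a).-1) ?(@ceil_divn _ (s * s) a); nia.
split=> [|v|v].
(* There are at least [k (s - 1)] symbols because the [k] vertices of a path already cover that many
   edges. *)
- have [|x [p [_ up sz]]] := exists_path hG (m := k); first by lia.
  have cP : #|[set:: x :: p]| = k by rewrite cardsE (card_uniqP up).
  have := coverage_lower hG (A := [set:: x :: p]).
  by rewrite cP => covP; apply: leq_trans (covP _ _) (max_card _); lia.
- exact: card_fr_code hG v.
have [e_sym e_irr e_deg _] := hG.
(* The helpers are the [s] neighbours of [v], and each sends the single shared edge, as
   [alpha / r = 1]. *)
exists [set u | e v u], (fun u => fr_code e v :&: fr_code e u); split=> //.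
- by rewrite inE e_irr.
- move=> u; rewrite inE => evu; rewrite subsetIr (fr_code_meet hG evu); lia.
- exact: fr_code_bigcup hG v.
Qed.
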